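(* Let $\lambda=\lambda^{<\lambda}$ be an infinite regular cardinal. Consider the statements: (1) There exists a $\lambda^+$-Luzin subset of ${}^{\lambda}\lambda$; (2) There exists a tight strongly unbounded coloring $c:\lambda\times\lambda^+\rightarrow\lambda$; (3) For every partition $\mathcal S$ of $E^{\lambda^+}_{\lambda}=\{\alpha<\lambda^+\mid \mathrm{cf}(\alpha)=\lambda\}$ into stationary sets, $\clubsuit_{\mathrm{ad}}(\mathcal S,\lambda,{<}\lambda)$ holds. Then (1) implies (2), and (2) implies (3).
   Context: For a set $\mathbb T\subseteq{}^{<\lambda}\lambda$ and $t\in{}^{<\lambda}\lambda$, ''$t\subseteq f$'' means $f$ extends $t$. A $\kappa$-Luzin subset of ${}^\lambda\lambda$ is a set $L\subseteq{}^\lambda\lambda$ of size $\kappa$ such that for every $B\in[L]^\kappa$ there is $t\in{}^{<\lambda}\lambda$ such that for every $t'\in{}^{<\lambda}\lambda$ extending $t$ there is an element of $B$ extending $t'$. For a regular uncountable cardinal $\kappa$, infinite cardinals $\nu,\lambda<\kappa$ and a coloring $c:\nu\times\kappa\rightarrow\lambda$: for $\beta<\kappa$ let $c_\beta:\nu\to\lambda$ be $c_\beta(\eta):=c(\eta,\beta)$. $c$ is strongly unbounded iff for every cofinal $B\subseteq\kappa$ there are $\eta<\nu$ and $t:\eta\to\lambda$ with $\sup\{c_\beta(\eta)\mid \beta\in B,\ t\subseteq c_\beta\}=\lambda$. For $\mathbb T\subseteq{}^{<\nu}\lambda$ let $[\mathbb T]_c:=\{\beta<\kappa\mid \forall\eta<\nu\,(c_\beta\restriction\eta\in\mathbb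 T)\}$, and $\mathcal T_c:=\{\mathbb T\subseteq{}^{<\nu}\lambda\mid \sup([\mathbb T]_c)=\kappa\}$. $c$ is tight iff $\mathrm{cf}(\mathcal T_c,\supseteq)\le\kappa$, where $\mathrm{cf}(\mathcal T_c,\supseteq)$ is the least size of a family $\mathcal D\subseteq\mathcal T_c$ such that every $\mathbb T\in\mathcal T_c$ contains some member of $\mathcal D$. For a regular uncountable $\kappa$, a collection $\mathcal S$ of stationary subsets of $\kappa$ and nonzero cardinals $\mu,\theta<\kappa$, $\clubsuit_{\mathrm{ad}}(\mathcal S,\mu,{<}\theta)$ asserts the existence of $\langle\mathcal A_\alpha\mid\alpha\in\bigcup\mathcal S\rangle$ such that: (i) for every limit ordinal $\alpha\in\bigcup\mathcal S$, $\mathcal A_\alpha$ is a pairwise disjoint family of $\mu$ many cofinal subsets of $\alpha$; (ii) for every $\mathcal B\subseteq[\kappa]^\kappa$ of size $<\theta$ and every $S\in\mathcal S$, there are stationarily many $\alpha\in S$ with $\sup(A\cap B)=\alpha$ for all $A\in\mathcal A_\alpha$, $B\in\mathcal B$; (iii) for all distinct $A,A'$ from $\bigcup_{S\in\mathcal S}\bigcup_{\alpha\in S}\mathcal A_\alpha$, $\sup(A\cap A')<\sup(A)$. *)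

(* Defs.v *)
From HB Require Import structures.
From mathcomp Require Import all_boot all_order.
From mathcomp Require Import all_classical.
From mathcomp Require wochoice.

Set Implicit Arguments.
Unset Strict Implicit.
Unset Printing Implicit Defensive.

Import Order.TTheory.

Local Open Scope order_scope.
Local Open Scope classical_set_scope.
Local Open Scope card_scope.

(* Ordinals are represented by well-ordered types: the elements of a
   well-ordered type [K] are the ordinals below (the ordinal represented by)
   [K], and cardinals are represented by initial ordinals. *)

Definition card_lt (T U : Type) (A : set T) (B : set U) : Prop :=
  A #<= B /\ ~ (B #<= A).

Definition below (d : Order.disp_t) (K : orderType d) (a : K) : set K :=
  [set x | x < a].

Definition is_cardinal (d : Order.disp_t) (K : orderType d) : Prop :=
  wochoice.well_order (<=%O : rel K) /\ forall a : K, card_lt (below a) [set: K].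

Definition is_infinite_cardinal (d : Order.disp_t) (K : orderType d) : Prop :=
  is_cardinal K /\ infinite_set [set: K].

(* Every cardinal below [K] is the cardinality of a subset of [K], so the last
   clause says that [K] is the least cardinal above [L]. *)
Definition is_succ_cardinal (d d' : Order.disp_t)
    (L : orderType d) (K : orderType d') : Prop :=
  [/\ is_cardinal K, card_lt [set: L] [set: K] &
      forall A : set K, card_lt A [set: K] -> A #<= [set: L]].

(* [sup A = K] for [A] a set of ordinals below [K]. *)
Definition unbounded (d : Order.disp_t) (K : orderType d) (A : set K) : Prop :=
  forall x : K, exists2 y, A y & x < y.

(* Both forms below use the weak inequality, so that they also give the right
   notion of cofinality at successor ordinals. *)
Definition cofinal (d : Order.disp_t) (K : orderType d) (A : set K) : Prop :=
  forall x : K, exists2 y, A y & x <= y.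

Definition cofinal_below (d : Order.disp_t) (K : orderType d)
    (A : set K) (a : K) : Prop :=
  A `<=` below a /\ forall x, x < a -> exists2 y, A y & x <= y.

(* cf(L) = L *)
Definition is_regular (d : Order.disp_t) (L : orderType d) : Prop :=
  (exists2 A : set L, cofinal A & A #= [set: L]) /\
  forall A : set L, cofinal A -> [set: L] #<= A.

(* cf(a) = L, for [a] an ordinal below [K] *)
Definition cofinality_is (d d' : Order.disp_t)
    (L : orderType d) (K : orderType d') (a : K) : Prop :=
  (exists2 A : set K, cofinal_below A a & A #= [set: L]) /\
  forall A : set K, cofinal_below A a -> [set: L] #<= A.

Definition E_cof (d d' : Order.disp_t) (L : orderType d) (K : orderType d') :
    set K :=
  [set a | cofinality_is L a].
Arguments E_cof {d d'} L K.

Definition limit_ordinal (d : Order.disp_t) (K : orderType d) (a : K) : Prop :=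
  (exists x, x < a) /\ forall x, x < a -> exists2 y, x < y & y < a.

Definition is_club (d : Order.disp_t) (K : orderType d) (C : set K) : Prop :=
  unbounded C /\
  forall a, limit_ordinal a -> supremums (C `&` below a) a -> C a.

Definition stationary (d : Order.disp_t) (K : orderType d) (S : set K) : Prop :=
  forall C : set K, is_club C -> S `&` C !=set0.

(* The functions from an ordinal below [N] to [L], i.e. ${}^{<N}L$. *)
Record pfun (d d' : Order.disp_t) (N : orderType d) (L : orderType d') :=
  Pfun { pdom : N ; pval : {x : N | x < pdom} -> L }.

Definition prestrict (d d' : Order.disp_t) (N : orderType d) (L : orderType d')
    (f : N -> L) (a : N) : pfun N L :=
  Pfun (fun x : {x : N | x < a} => f (sval x)).

(* $t\subseteq f$ for a total function [f] *)
Definition extended_by (d d' : Order.disp_t) (N : orderType d)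
    (L : orderType d') (t : pfun N L) (f : N -> L) : Prop :=
  forall x : {x : N | x < pdom t}, pval x = f (sval x).

(* $t\subseteq t'$ for partial functions *)
Definition pextended_by (d d' : Order.disp_t) (N : orderType d)
    (L : orderType d') (t t' : pfun N L) : Prop :=
  forall x : {x : N | x < pdom t},
    exists2 x' : {x : N | x < pdom t'}, sval x' = sval x & pval x' = pval x.

Definition is_luzin (d d' : Order.disp_t) (L : orderType d) (K : orderType d')
    (X : set (L -> L)) : Prop :=
  X #= [set: K] /\
  forall B : set (L -> L), B `<=` X -> B #= [set: K] ->
    exists t : pfun L L, forall t' : pfun L L, pextended_by t t' ->
      exists2 f, B f & extended_by t' f.

Section Colorings.
Variables (dN dK dL : Order.disp_t).
Variables (N : orderType dN) (K : orderType dK) (L : orderType dL).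
Variable c : N -> K -> L.

Definition strongly_unbounded : Prop :=
  forall B : set K, cofinal B ->
    exists t : pfun N L,
      unbounded [set c (pdom t) b | b in [set b | B b /\ extended_by t (c^~ b)]].

Definition branches (T : set (pfun N L)) : set K :=
  [set b | forall a : N, T (prestrict (c^~ b) a)].

Definition large_trees : set (set (pfun N L)) :=
  [set T | unbounded (branches T)].

(* cf(large_trees, superset) <= K *)
Definition tight : Prop :=
  exists D : set (set (pfun N L)),
    [/\ D `<=` large_trees,
        forall T, large_trees T -> exists2 T', D T' & T' `<=` T &
        D #<= [set: K]].

End Colorings.

(* [A] is only relevant on the union of [S]; [M] and [Th] represent the
   cardinals mu and theta. *)
Definition club_ad (dK dM dTh : Order.disp_t) (K : orderType dK)
    (S : set (set K)) (M : orderType dM) (Th : orderType dTh) : Prop :=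
  exists A : K -> set (set K),
    [/\ forall a, (\bigcup_(X in S) X) a -> limit_ordinal a ->
          [/\ trivIset (A a) id, A a #= [set: M] &
              forall Y, A a Y -> cofinal_below Y a],
        forall B : set (set K), (forall Z, B Z -> Z #= [set: K]) ->
          card_lt B [set: Th] ->
          forall X, S X ->
            stationary [set a | X a /\
              forall Y Z, A a Y -> B Z -> supremums (Y `&` Z) a] &
        forall Y Y', (\bigcup_(X in S) \bigcup_(a in X) A a) Y ->
          (\bigcup_(X in S) \bigcup_(a in X) A a) Y' -> Y <> Y' ->
          exists s s', [/\ supremums (Y `&` Y') s, supremums Y s' & s < s']].

(* Main.v *)
Require Import Defs.
From mathcomp Require Import all_boot all_order.
From mathcomp Require Import all_classical.

Set Implicit Arguments.
Unset Strict Implicit.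
Unset Printing Implicit Defensive.

Import Order.TTheory.

Local Open Scope order_scope.
Local Open Scope classical_set_scope.
Local Open Scope card_scope.

(* Write c_b for the function x |-> c x b.

   A Luzin set is enumerated as the family of all c_b; the trees of sequences
   compatible with a fixed t, at most L in number, then witness tightness.

   For the second implication, fix a dense family D of at most K large trees.  Each unbounded
   set Z contains, for a suitable T in D, unboundedly many b with c_b extending
   any given s in T.  By Ulam's theorem every stationary set splits into K
   stationary sets, so each a of cofinality L can be assigned fewer than L trees
   of D in such a way that every such list occurs stationarily often.  For each
   tree T assigned to a, pick a branch y = c_g with g >= a, all branches being
   distinct, and consider, as in Todorcevic's constructions from an unbounded
   family,
     near a y = {b < a | E a b <= y n, n being the first place where c_b and y differ},
   where E a is an L-valued function on a with {b | E a b <= m} bounded in every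
   a' <= a of cofinality L.  Two such sets for distinct branches are almost
   disjoint.  If near a y were to miss Z above some point below a for
   stationarily many a, pressing down freezes that point and the values of E a on
   an interval which realizes all of T in Z; strong unboundedness of the
   corresponding branches then yields an a with a large value y n, and an element
   of Z in near a y. *)

(** * Cardinal inequalities as injections and surjections *)

Lemma card_le_injW (T U : Type) (A : set T) (B : set U) (f : T -> U) :
  (forall x, A x -> B (f x)) ->
  (forall x y, A x -> A y -> f x = f y -> x = y) -> A #<= B.
Proof.
move=> fAB f_inj.
have f_in : {in A &, injective f} by move=> x y /set_mem Ax /set_mem Ay; exact: f_inj.
apply: (@card_le_trans _ _ _ (f @` A)).
  by have := inj_card_eq f_in; rewrite card_eq_sym card_eq_le => /andP[].
by apply: subset_card_le => _ [x Ax <-]; exact: fAB.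
Qed.

Lemma card_le_inj (T U : Type) (u0 : U) (A : set T) (B : set U) :
  A #<= B ->
  exists f : T -> U, (forall x, A x -> B (f x)) /\
    (forall x y, A x -> A y -> f x = f y -> x = y).
Proof.
move=> /card_leP[f].
exists (fun x => if pselect (A x) is left Ax then val (f (SigSub (mem_set Ax))) else u0).
split=> [x Ax|x y Ax Ay].
  case: pselect => // Ax'; exact: set_mem (valP _).
case: pselect => // Ax'; case: pselect => // Ay' /val_inj fxy.
have := @inj _ _ _ f (SigSub (mem_set Ax')) (SigSub (mem_set Ay')).
by move=> /(_ (mem_set I) (mem_set I) fxy) [].
Qed.

Lemma card_le_surj (T U : Type) (t0 : T) (A : set T) (B : set U) :
  A #<= B -> exists f : U -> T, forall x, A x -> exists2 y, B y & f y = x.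
Proof.
move=> AB.
have [u0|noU] := pselect (inhabited U); last first.
  exists (fun=> t0) => x Ax; exfalso; apply: noU.
  by move/card_leP: AB => [f]; exact: (inhabits (val (f (SigSub (mem_set Ax))))).
case: u0 => u0; have [g [gB g_inj]] := card_le_inj u0 AB.
pose f y := if pselect (exists2 x, A x & g x = y) is left e then s2val (cid2 e) else t0.
exists f => x Ax; exists (g x); first exact: gB.
rewrite /f; case: pselect => [e|[]]; last by exists x.
by case: cid2 => z /= Az gz; exact: g_inj.
Qed.


(** * Well-orders and choice by recursion *)

Lemma well_order_min (d : Order.disp_t) (K : orderType d) :
  wochoice.well_order (<=%O : rel K) ->
  forall A : set K, A !=set0 -> exists2 m, A m & forall y, A y -> m <= y.
Proof.
move=> K_wo A [x Ax].
have [|m [[]]] := K_wo (mem A); first by exists x; rewrite inE.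
rewrite inE => Am m_min _; exists m => // y Ay.
by apply: m_min; rewrite inE.
Qed.

Lemma well_order_wf (d : Order.disp_t) (K : orderType d) :
  wochoice.well_order (<=%O : rel K) -> well_founded (fun x y : K => x < y).
Proof.
move=> K_wo x; apply: contrapT => nx.
have [|m nm m_min] := @well_order_min _ K K_wo [set y | ~ Acc (fun x y : K => x < y) y].
  by exists x.
apply: nm; constructor => y ym; apply: contrapT => /m_min.
by rewrite leNgt ym.
Qed.

(** By well-founded recursion: the hypothesis is applied to the values chosen so far, extended by
    the default [y0] outside the predecessors of [i]. *)
Lemma avoiding_choice (I Y : Type) (y0 : Y) (R : I -> I -> Prop) (U : I -> set Y) :
  well_founded R ->
  (forall i (h : I -> Y), exists2 y, U i y & forall i', R i' i -> h i' <> y) ->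
  exists g : I -> Y, (forall i, U i (g i)) /\
    forall i i', R i' i -> g i' <> g i.
Proof.
move=> R_wf U_large.
pose h i (rec : forall i', R i' i -> Y) i' :=
  if pselect (R i' i) is left r then rec i' r else y0.
pose F i rec := s2val (cid2 (U_large i (h i rec))).
pose g := Fix R_wf (fun=> Y) F.
have gE i : g i = F i (fun i' _ => g i').
  apply: Fix_eq => {}i f f' ff'; congr (F i _).
  by apply: functional_extensionality_dep => j; apply: functional_extensionality_dep => r.
exists g; split=> [i|i i' Ri].
  by rewrite gE /F; case: cid2.
rewrite [g i]gE /F; case: cid2 => y /= _ /(_ i' Ri).
by rewrite /h; case: pselect.
Qed.

(** * Restrictions and extensions of partial functions *)

Section PartialFunctions.
Variables (d d' : Order.disp_t) (N : orderType d) (L : orderType d').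
Implicit Types (t : pfun N L) (f g : N -> L) (a : N).

(** Reading values through [option] lets partial functions be compared although the type of [pval]
    depends on the domain. *)
Definition pget t x : option L :=
  if pselect (x < pdom t) is left xt then Some (pval (exist _ x xt)) else None.

Lemma prestrict_inj f g a :
  prestrict f a = prestrict g a -> forall x, x < a -> f x = g x.
Proof.
move=> fg x xa; have := congr1 (pget ^~ x) fg.
by rewrite /pget /=; case: pselect => // ? [].
Qed.

Lemma extended_byP t f : extended_by t f <-> t = prestrict f (pdom t).
Proof.
split=> [|->]; last by move=> x.
case: t => a v tf; rewrite /prestrict /=; f_equal.
by apply: functional_extensionality_dep => x; exact: tf.
Qed.

Lemma extended_by_prestrict f g a :
  extended_by (prestrict f a) g <-> forall x, x < a -> f x = g x.
Proof. by split=> [fg x xa|fg [x xa]]; [exact: (fg (exist _ x xa))|exact: fg]. Qed.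

End PartialFunctions.

Section SuccessorCardinal.
Variables (d d' : Order.disp_t) (L : orderType d) (K : orderType d').
Hypotheses (L_card : is_infinite_cardinal L) (L_reg : is_regular L).
Hypothesis L_pow : [set: L] #= [set: pfun L L].
Hypothesis K_succ : is_succ_cardinal L K.

(** * Sets of size less than [L] and their bounds *)

Definition small (I : Type) (A : set I) : Prop := ~ ([set: L] #<= A).

Let L_wo : wochoice.well_order (<=%O : rel L). Proof. by case: L_card => -[]. Qed.
Let K_wo : wochoice.well_order (<=%O : rel K). Proof. by case: K_succ => -[]. Qed.

Lemma L_inhabited : inhabited L.
Proof.
by case: L_card => _ /infinite_setN0[x _]; exact: inhabits x.
Qed.

Lemma small_card_le (I J : Type) (A : set I) (B : set J) :
  A #<= B -> small B -> small A.
Proof. by move=> AB B_small LA; apply: B_small; exact: card_le_trans AB. Qed.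

Lemma small_image (I J : Type) (A : set I) (f : I -> J) : small A -> small (f @` A).
Proof. by apply: small_card_le; exact: card_image_le. Qed.

Lemma small_bounded (I : Type) (A : set I) (f : I -> L) :
  small A -> exists x, forall i, A i -> f i < x.
Proof.
move=> /(@small_image _ _ _ f) fA; apply: contrapT => nx; apply: fA.
apply: (proj2 L_reg) => x; apply: contrapT => nc; apply: nx; exists x => i Ai.
by rewrite ltNge; apply/negP => xi; apply: nc; exists (f i) => //; exists i.
Qed.

Lemma L_gt (x : L) : exists y, x < y.
Proof.
apply: contrapT => nx; have : cofinal [set x].
  move=> y; exists x => //; rewrite leNgt; apply/negP => xy.
  by apply: nx; exists y.
move/(proj2 L_reg) => Lx; case: L_card => _; apply.
by apply: (card_le_finite Lx); exact: finite_set1.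
Qed.

Lemma small_below (a : L) : small (below a).
Proof. by case: L_card => -[_ /(_ a)[]]. Qed.

Lemma small_le (a : L) : small [set x | x <= a].
Proof.
have [b ab] := L_gt a; apply: (small_card_le _ (@small_below b)).
by apply: subset_card_le => x /= xa; exact: le_lt_trans xa ab.
Qed.

Lemma small_bounded_cof (a : K) (I : Type) (A : set I) (f : I -> K) :
  E_cof L K a -> small A -> (forall i, A i -> f i < a) ->
  exists2 x, x < a & forall i, A i -> f i < x.
Proof.
move=> [_ a_cof] /(@small_image _ _ _ f) fA fa; apply: contrapT => nx; apply: fA.
apply: a_cof; split=> [_ [i Ai <-]|x xa]; first exact: fa.
apply: contrapT => nc; apply: nx; exists x => // i Ai.
by rewrite ltNge; apply/negP => xi; apply: nc; exists (f i) => //; exists i.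
Qed.

Lemma E_cof_limit (a : K) : E_cof L K a -> limit_ordinal a.
Proof.
move=> aE; split.
  have [||x xa _] := @small_bounded_cof a L set0 (fun=> a) aE _ _; last by exists x.
    by have [l] := L_inhabited; rewrite /small card_le0 => /eqP/seteqP[/(_ l I)].
  by [].
move=> x xa; have [||y ya xy] := @small_bounded_cof a K [set x] id aE _ _.
- move=> Lx; case: L_card => _; apply.
  by apply: (card_le_finite Lx); exact: finite_set1.
- by move=> _ ->.
- by exists y => //; exact: xy.
Qed.

Lemma pfun_card_le (A : set (pfun L L)) : A #<= [set: L].
Proof.
apply: (@card_le_trans _ _ _ [set: pfun L L]); first exact: card_leT.
by have := L_pow; rewrite card_eq_le => /andP[].
Qed.

(** A pair is coded by a sequence of length [l2] with value [a] at [l0] and [b] elsewhere; [L_pow]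
    numbers such sequences by elements of [L]. *)
Lemma L_pairing : exists pr : L -> L -> L,
  forall a b a' b', pr a b = pr a' b' -> a = a' /\ b = b'.
Proof.
have [l0] := L_inhabited; have [l1 l01] := L_gt l0; have [l2 l12] := L_gt l1.
have [e [_ e_inj]] := card_le_inj l0 (@pfun_card_le setT).
exists (fun a b => e (prestrict (fun x => if x == l0 then a else b) l2)).
move=> a b a' b' /(e_inj _ _ I I) /prestrict_inj ab; split.
  by have := ab l0 (lt_trans l01 l12); rewrite eqxx.
by have := ab l1 l12; rewrite gt_eqF.
Qed.

(** * Bounded and unbounded subsets of the successor cardinal *)

Lemma below_card_le (a : K) : below a #<= [set: L].
Proof. by case: K_succ => -[_ a_lt] _; apply; exact: a_lt. Qed.

Lemma below_inj : exists e : K -> K -> L, forall a x y,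
  x < a -> y < a -> e a x = e a y -> x = y.
Proof.
have [l0] := L_inhabited.
have /choice[e eP] : forall a : K, exists e : K -> L, forall x y,
    x < a -> y < a -> e x = e y -> x = y.
  by move=> a; have [e [_ ?]] := card_le_inj l0 (@below_card_le a); exists e.
by exists e.
Qed.

Lemma not_K_le_L : ~ ([set: K] #<= [set: L]).
Proof. by case: K_succ => _ []. Qed.

Lemma K_inhabited : inhabited K.
Proof.
apply: contrapT => nK; apply: not_K_le_L; have [l] := L_inhabited.
by apply: (@card_le_injW _ _ _ _ (fun=> l)) => // x; case: nK; exact: inhabits x.
Qed.

(** Regularity of [K]: if the values were cofinal, each [x] would be coded in [L] by an index [i]
    with [x <= f i], the number of [x] under [e (f i)], and a flag for [x = f i], where that number
    means nothing. *)
Lemma K_bounded (I : Type) (A : set I) (f : I -> K) :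
  A #<= [set: L] -> exists x, forall i, A i -> f i < x.
Proof.
move=> AL; apply: contrapT => nx; apply: not_K_le_L.
have [l0] := L_inhabited; have [l1 l01] := L_gt l0.
have [pr prI] := L_pairing; have [e eI] := below_inj.
have [u [_ uI]] := card_le_inj l0 AL.
have /choice[g gP] : forall x, exists i, A i /\ x <= f i.
  move=> x; apply: contrapT => nc; apply: nx; exists x => i Ai.
  by rewrite ltNge; apply/negP => xi; apply: nc; exists i.
apply: (@card_le_injW _ _ _ _ (fun x => pr (u (g x))
  (pr (e (f (g x)) x) (if x == f (g x) then l0 else l1)))) => // x y _ _.
move=> /prI[/uI gxy /prI[exy cxy]].
have {}gxy : g x = g y by apply: gxy; case: (gP x); case: (gP y).
have [_ xle] := gP x; have [_ yle] := gP y; move: exy cxy xle yle; rewrite -gxy.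
move: (f (g x)) => z; case: (eqVneq x z) => [->|xz]; case: (eqVneq y z) => [->|yz] //.
- by move=> _ c; move: l01; rewrite c ltxx.
- by move=> _ c; move: l01; rewrite c ltxx.
- by move=> exy _ xle yle; apply: eI exy; rewrite lt_neqAle ?xz ?yz.
Qed.

Lemma K_gt (x : K) : exists y, x < y.
Proof.
have [|y xy] := @K_bounded L setT (fun=> x); first exact: card_lexx.
by have [l] := L_inhabited; exists y; exact: xy l I.
Qed.

Lemma L_card_le_K : [set: L] #<= [set: K].
Proof. by case: K_succ => _ []. Qed.

Lemma K_bounded_fun (I : Type) (f : I -> K -> K) :
  [set: I] #<= [set: L] -> exists F : K -> K, forall x i, f i x < F x.
Proof.
move=> IL; have /choice[F FP] : forall x, exists y, forall i, f i x < y.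
  by move=> x; have [y yP] := @K_bounded I setT (f ^~ x) IL; exists y => i; exact: yP.
by exists F.
Qed.

Lemma unbounded_card_ge (A : set K) : unbounded A -> [set: K] #<= A.
Proof.
move=> A_unb; apply: contrapT => nKA.
have AL : A #<= [set: L].
  by case: K_succ => _ _; apply; split=> //; exact: card_leT.
have [x xP] := @K_bounded _ _ id AL; have [y Ay xy] := A_unb x.
by have := lt_trans xy (xP _ Ay); rewrite ltxx.
Qed.

Lemma card_eq_unbounded (A : set K) : A #= [set: K] -> unbounded A.
Proof.
move=> AK x; apply: contrapT => nx; have [y xy] := K_gt x.
have KA : [set: K] #<= A by move: AK; rewrite card_eq_le => /andP[].
apply: not_K_le_L; apply: (card_le_trans KA).
apply: card_le_trans (@below_card_le y); apply: subset_card_le => z Az.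
apply: le_lt_trans xy; rewrite leNgt; apply/negP => xz.
by apply: nx; exists z.
Qed.

Lemma unbounded_fiber (J : Type) (A : set K) (f : K -> J) :
  [set: J] #<= [set: L] -> unbounded A ->
  exists i, unbounded (A `&` f @^-1` [set i]).
Proof.
move=> IL A_unb; apply: contrapT => nu.
have /choice[b bP] : forall i, exists x, forall y, A y -> f y = i -> y <= x.
  move=> i; apply: contrapT => nb; apply: nu; exists i => x.
  apply: contrapT => nc; apply: nb; exists x => y Ay fy.
  by rewrite leNgt; apply/negP => xy; apply: nc; exists y.
have [x xP] := @K_bounded _ _ b IL; have [y Ay xy] := A_unb x.
have := lt_le_trans xy (bP _ _ Ay erefl).
by move/lt_trans => /(_ _ (xP _ I)); rewrite ltxx.
Qed.

(** * Clubs, stationary sets and Ulam's splitting *)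

Definition closed_under (F : K -> K) (a : K) : Prop :=
  limit_ordinal a /\ forall x, x < a -> F x < a.

Lemma le_card_le (a : K) : [set x | x <= a] #<= [set: L].
Proof.
have [b ab] := K_gt a; apply: card_le_trans (below_card_le b).
by apply: subset_card_le => x /= xa; exact: le_lt_trans xa ab.
Qed.

Lemma nat_card_le : [set: nat] #<= [set: L].
Proof. by apply/infiniteP; case: L_card. Qed.

Lemma closed_under_club (F : K -> K) : is_club (closed_under F).
Proof.
split=> [x0|a a_lim [_ a_sup]]; last first.
  split=> // x xa; have [y [[_ yF] ya] xy] : exists2 y, closed_under F y /\ y < a & x < y.
    apply: contrapT => ny; suff : a <= x by rewrite leNgt xa.
    apply: a_sup => y [yF ya]; rewrite leNgt; apply/negP => xy; apply: ny.
    by exists y.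
  exact: lt_trans (yF _ xy) ya.
have /choice[G GP] : forall x, exists z, x < z /\ forall y, y <= x -> F y < z.
  move=> x; have [z zP] := @K_bounded _ _ F (le_card_le x); have [z' xz'] := K_gt x.
  exists (Order.max z z'); split; first by rewrite lt_max xz' orbT.
  by move=> y yx; rewrite lt_max zP.
(* The closure point is the supremum of countably many iterates; it exists in [K] because [nat]
   embeds in [L]. *)
pose s n := iter n G (G x0).
have [b bP] := @K_bounded _ _ s nat_card_le.
have [|a aP a_min] := well_order_min K_wo (A := [set z | forall n, s n < z]).
  by exists b => n; exact: bP.
have a_lim z : z < a -> exists n, z <= s n.
  move=> za; apply: contrapT => nz.
  suff : a <= z by rewrite leNgt za.
  apply: a_min => n; by rewrite ltNge; apply/negP => zn; apply: nz; exists n.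
exists a; last by apply: lt_trans (aP 0%N); case: (GP x0).
split; [split|].
- by exists (s 0%N); exact: aP.
- move=> z /a_lim[n zn]; exists (s n.+1); last exact: aP.
  by apply: le_lt_trans zn _; rewrite /s iterS; case: (GP (iter n G (G x0))).
- move=> z /a_lim[n zn]; apply: lt_trans (aP n.+1).
  by rewrite /s iterS; case: (GP (iter n G (G x0))) => _; exact.
Qed.

(** Closure points can replace clubs: if [F] picks a point of the club [C] above each [x], then
    every closure point of [F] is in [C]. *)
Lemma stationaryP (W : set K) :
  stationary W <-> forall F, exists2 a, W a & closed_under F a.
Proof.
split=> [W_st F|W_st C [C_unb C_cl]].
  by have [a [Wa aF]] := W_st _ (closed_under_club F); exists a.
have /choice[F FP] : forall x, exists y, C y /\ x < y.
  by move=> x; have [y Cy xy] := C_unb x; exists y.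
have [a Wa [a_lim aF]] := W_st F; exists a; split=> //.
apply: C_cl => //; split=> [y [_ /ltW]//|z zP].
rewrite leNgt; apply/negP => za; have [CF zF] := FP z.
by have := zP (F z) (conj CF (aF _ za)); rewrite leNgt zF.
Qed.

Lemma not_stationaryP (W : set K) :
  ~ stationary W -> exists F, forall a, W a -> ~ closed_under F a.
Proof.
move=> nW; apply: contrapT => nF; apply: nW; apply/stationaryP => F.
apply: contrapT => na; apply: nF; exists F => a Wa aF.
by apply: na; exists a.
Qed.

Lemma stationary_sub (W W' : set K) : W `<=` W' -> stationary W -> stationary W'.
Proof. by move=> WW' W_st C /W_st[a [/WW' ? ?]]; exists a. Qed.

Lemma stationary_closed (W : set K) (F : K -> K) :
  stationary W -> stationary [set a | W a /\ closed_under F a].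
Proof.
move=> /stationaryP W_st; apply/stationaryP => G.
have [a Wa [a_lim aFG]] := W_st (fun x => Order.max (F x) (G x)).
exists a; [split=> //|]; split=> // x /aFG; rewrite gt_max => /andP[] //.
Qed.

Lemma stationary_unbounded (W : set K) : stationary W -> unbounded W.
Proof.
move=> /stationaryP W_st x; have [a Wa [[[y ya] _] aF]] := W_st (fun=> x).
by exists a => //; exact: aF ya.
Qed.

(** The nonstationary ideal is closed under unions of [L] many sets: a closure point of one [G]
    dominating all [F j] is a closure point of each. *)
Lemma stationary_avoid (J : Type) (W : set K) (N : J -> set K) :
  [set: J] #<= [set: L] -> stationary W -> (forall j, ~ stationary (N j)) ->
  stationary [set a | W a /\ forall j, ~ N j a].
Proof.
move=> JL W_st N_ns; have /choice[F FP] := fun j => not_stationaryP (N_ns j).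
have [G GP] := K_bounded_fun F JL.
apply: stationary_sub (stationary_closed G W_st) => a [Wa [a_lim aG]].
split=> // j Nja; apply: (FP j a Nja); split=> // x xa.
exact: lt_trans (GP _ _) (aG _ xa).
Qed.

Lemma stationary_fiber (J : Type) (W : set K) (P : K -> J -> Prop) :
  [set: J] #<= [set: L] -> stationary W -> (forall a, W a -> exists j, P a j) ->
  exists j, stationary [set a | W a /\ P a j].
Proof.
move=> JL W_st WP; apply: contrapT => nj.
have /stationary_unbounded : stationary [set a | W a /\ forall j, ~ [set a | W a /\ P a j] a].
  by apply: stationary_avoid => // j Pj; apply: nj; exists j.
by have [k] := K_inhabited; move=> /(_ k)[a [Wa na] _]; have [j Pj] := WP a Wa; apply: (na j).
Qed.

(** If every fiber had a witness [F x] of nonstationarity, a closure point [a] of [G], which bounds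
    [F y w] for [y] and [w] up to [x], would be closed under all [F x] with [x < a], a diagonal
    intersection. *)
Lemma fodor (W : set K) (P : K -> K -> Prop) :
  stationary W -> (forall a, W a -> exists2 x, x < a & P a x) ->
  exists x, stationary [set a | W a /\ P a x].
Proof.
move=> W_st WP; apply: contrapT => nx.
have /choice[F FP] : forall x, exists F, forall a, W a /\ P a x -> ~ closed_under F a.
  by move=> x; apply: not_stationaryP => st; apply: nx; exists x.
have /choice[G GP] : forall x, exists z, forall y, y <= x -> forall w, w <= x -> F y w < z.
  move=> x.
  have /choice[z zP] : forall y, exists z, forall w, w <= x -> F y w < z.
    by move=> y; have [z zP] := @K_bounded _ _ (F y) (le_card_le x); exists z.
  have [z' z'P] := @K_bounded _ _ z (le_card_le x); exists z' => y yx w wx.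
  exact: lt_trans (zP y w wx) (z'P _ yx).
have [a [Wa [a_lim aG]]] : exists a, W a /\ closed_under G a.
  by have /stationaryP/(_ G)[a] := W_st; exists a.
have [x xa Pax] := WP a Wa; apply: (FP x a (conj Wa Pax)); split=> // y ya.
apply: lt_trans (aG (Order.max x y) _); last by rewrite gt_max xa.
by apply: GP; rewrite le_max lexx ?orbT.
Qed.

(** Ulam's matrix: for each [g], some value [xi g] of [e a g] is taken stationarily often.
    Unboundedly many [g] share the same [l], and their pieces are disjoint since [e a] is injective
    below [a]. *)
Lemma ulam_split (W : set K) : stationary W ->
  exists f : K -> K, forall v, stationary [set a | W a /\ f a = v].
Proof.
move=> W_st; have [e eI] := below_inj.
have /choice[xi xiP] : forall g, exists l : L, stationary
    [set a | (W a /\ g < a) /\ e a g = l].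
  move=> g; apply: stationary_fiber; first exact: card_lexx; last by move=> a _; exists (e a g).
  apply: stationary_sub (stationary_closed (fun=> g) W_st) => a [Wa [[[x xa] _] aF]].
  by split=> //; exact: aF xa.
have [k] := K_inhabited.
have [l l_unb] : exists l, unbounded (setT `&` xi @^-1` [set l]).
  by apply: unbounded_fiber; [exact: card_lexx|move=> x; have [y] := K_gt x; exists y].
have [r rP] := card_le_surj k (unbounded_card_ge l_unb).
pose f a := if pselect (exists2 g, g < a & xi g = l /\ e a g = l) is left ex
            then r (s2val (cid2 ex)) else k.
exists f => v; have [g [_ gl] <-] := rP v I.
apply: stationary_sub (xiP g) => a [[Wa ga] eg]; split=> //.
rewrite /f; case: pselect => [ex|[]]; last by exists g => //; split=> //; rewrite eg.
by case: cid2 => h /= ha [_ eh]; congr r; apply: (eI a) => //; rewrite eh eg.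
Qed.

(** Each member of [S] is split, then each piece again, giving a pair of labels; disjointness lets
    [a] determine its own member of [S]. *)
Lemma stationary_split2 (S : set (set K)) :
  trivIset S id -> (forall X, S X -> stationary X) ->
  exists f : K -> K * K, forall X v, S X -> stationary [set a | X a /\ f a = v].
Proof.
move=> S_triv S_st.
have /choice[f fP] : forall X, exists f : K -> K * K,
    S X -> forall v, stationary [set a | X a /\ f a = v].
  move=> X; have [SX|nSX] := pselect (S X); last by exists (fun a => (a, a)).
  have [f1 f1P] := ulam_split (S_st X SX).
  have /choice[f2 f2P] := fun v => ulam_split (f1P v).
  exists (fun a => (f1 a, f2 (f1 a) a)) => _ [v w].
  apply: stationary_sub (f2P v w) => a [[Xa fa] f2a]; split=> //.
  by rewrite fa f2a.
have /choice[X XP] : forall a, exists X, (exists2 Y, S Y & Y a) -> S X /\ X a.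
  move=> a; have [[Y SY Ya]|nY] := pselect (exists2 Y, S Y & Y a); first by exists Y.
  by exists set0 => /nY.
exists (fun a => f (X a) a) => Y v SY.
apply: stationary_sub (fP Y SY v) => a [Ya fa]; split=> //.
have [SX Xa] : S (X a) /\ X a a by apply: XP; exists Y.
suff -> : X a = Y by [].
by apply: S_triv => //; exists a.
Qed.

(** * From a Luzin set to a tight strongly unbounded coloring *)

Lemma unbounded_card_eq (A : set K) : unbounded A -> A #= [set: K].
Proof. by move=> A_unb; rewrite card_eq_le card_leT unbounded_card_ge. Qed.

Lemma cofinal_unbounded (A : set K) : cofinal A -> unbounded A.
Proof.
move=> A_cof x; have [y xy] := K_gt x; have [z Az yz] := A_cof y.
by exists z => //; exact: lt_le_trans xy yz.
Qed.

(** A total extension of [t] that prescribes the value [v] at [pdom t]. *)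
Definition pfill (t : pfun L L) (v : L) : L -> L :=
  fun x => if pget t x is Some w then w else v.

Lemma pfill_extends t v : extended_by t (pfill t v).
Proof.
move=> [x xt]; rewrite /pfill /pget; case: pselect => //= xt'.
by rewrite (bool_irrelevance xt xt').
Qed.

Lemma pfill_out t v x : pdom t <= x -> pfill t v x = v.
Proof. by rewrite /pfill /pget leNgt => /negP tx; case: pselect. Qed.

Lemma pextended_by_prestrict (t : pfun L L) g a :
  pdom t <= a -> extended_by t g -> pextended_by t (prestrict g a).
Proof.
move=> ta tg [x xt]; have xa : x < a := lt_le_trans xt ta.
by exists (exist _ x xa) => //=; rewrite tg.
Qed.

Lemma luzin_coloring (X : set (L -> L)) : is_luzin K X ->
  exists c : L -> K -> L, tight c /\ strongly_unbounded c.
Proof.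
move=> [XK X_luzin]; have [l0] := L_inhabited.
have KX : [set: K] #<= X by move: XK; rewrite card_eq_le => /andP[].
have [f [fX f_inj]] := card_le_inj (fun=> l0) KX.
(* The Luzin property in terms of indices, with total functions cut at [a] in place of partial
   extensions of [t]. *)
have dense (B : set K) : unbounded B -> exists t : pfun L L,
    forall g a, pdom t <= a -> extended_by t g ->
    exists2 b, B b & forall x, x < a -> g x = f b x.
  move=> B_unb; have [||t tP] := X_luzin (f @` B).
  - by move=> _ [b _ <-]; exact: fX.
  - apply: (@card_eq_trans _ _ _ (f @` B) B); last exact: unbounded_card_eq.
    by apply: inj_card_eq => x y _ _; exact: f_inj.
  exists t => g a ta tg; have [_ [b Bb <-]] := tP _ (pextended_by_prestrict ta tg).
  by move=> /extended_by_prestrict; exists b.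
exists (fun x b => f b x); split; last first.
  move=> B /cofinal_unbounded/dense[t tP]; exists t => x.
  (* A value above [x] is prescribed at [pdom t]; [a] lies past [pdom t], so that some [f b] takes
     this value. *)
  have [v xv] := L_gt x; have [a ta] := L_gt (pdom t).
  have [b Bb bP] := tP _ _ (ltW ta) (@pfill_extends t v).
  exists v => //; exists b; last by rewrite -bP // pfill_out.
  split=> // -[y yt]; rewrite (@pfill_extends t v) /= bP //.
  exact: lt_trans yt ta.
pose ext (s : pfun L L) : set K := [set b | extended_by s (f b)].
pose tree t := [set s : pfun L L | exists2 g, extended_by t g & extended_by s g].
exists (large_trees (fun x b => f b x) `&` range tree); split=> [T []//|T T_large|].
  (* There are only [L] many [s] with [ext s] bounded. Past a common bound [x], any [s] that some
     [f y] extends is extended unboundedly often. *)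
  have /choice[b bP] : forall s, exists x, forall y, ext s y -> y <= x \/ unbounded (ext s).
    move=> s; apply: contrapT => nx; have us : unbounded (ext s).
      move=> x; apply: contrapT => ny; apply: nx; exists x => y sy; left.
      by rewrite leNgt; apply/negP => xy; apply: ny; exists y.
    by have [k] := K_inhabited; apply: nx; exists k => y _; right.
  have [x xP] := @K_bounded _ _ b (@pfun_card_le setT).
  have ext_unb s y : x < y -> ext s y -> unbounded (ext s).
    move=> xy /bP[yb|//]; have := lt_trans (lt_le_trans xy yb) (xP s I).
    by rewrite ltxx.
  have [|t tP] := dense [set y | branches (fun x b => f b x) T y /\ x < y].
    move=> z; have [y Ty] := T_large (Order.max x z).
    by rewrite gt_max => /andP[xy zy]; exists y.
  exists (tree t).
    split; last by exists t.
    have [y [Ty xy] yP] := tP _ _ (lexx _) (@pfill_extends t l0).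
    have ty : ext t y by case=> z zt; rewrite (@pfill_extends t l0) yP.
    move=> z; have [w tw zw] := ext_unb t y xy ty z; exists w => // a.
    by exists (f w) => //; apply/extended_by_prestrict.
  (* A node [s] compatible with [t] lies on some [g] extending [t]; by density a branch of [T]
     follows [g] up to [a], so [s] is in [T]. *)
  move=> s [g tg sg]; pose a := Order.max (pdom t) (pdom s).
  have [||y [Ty _] yP] := tP g a => //; first by rewrite le_max lexx.
  suff -> : s = prestrict (f y) (pdom s) by exact: Ty.
  apply/extended_byP => -[z zs]; rewrite sg /= yP //.
  by apply: lt_le_trans zs _; rewrite le_max lexx orbT.
apply: (@card_le_trans _ _ _ (range tree)); first by apply: subset_card_le => T [].
apply: card_le_trans L_card_le_K.
by apply: card_le_trans (@pfun_card_le setT); exact: card_image_le.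
Qed.

(** * Scales, sets near a branch, and labels of stationary sets *)

Section Guessing.
Variable e : K -> K -> L.
Hypothesis eI : forall a x y, x < a -> y < a -> e a x = e a y -> x = y.

(* Below a', the function E depends on a only through t < a and k, which can be
   frozen on a stationary set of points a. *)
Definition scale (a : K) (E : K -> L) : Prop :=
  (forall a' m, E_cof L K a' -> a' <= a ->
     exists2 x, x < a' & forall b, x <= b -> b < a' -> m < E b) /\
  (forall a', E_cof L K a' -> a' < a ->
     exists x t k, [/\ x < a', t < a &
       forall b, x <= b -> b < a' -> E b = Order.max k (e t b)]).

Lemma cofinal_enum (a : K) : E_cof L K a -> exists l : L -> K,
  (forall n, l n < a) /\ forall x, x < a -> exists n, x <= l n.
Proof.
move=> aE; have [[x0 x0a] _] := E_cof_limit aE.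
have [[A [Aa A_cof] AL] _] := aE.
have {AL} : A #<= [set: L] by move: AL; rewrite card_eq_le => /andP[].
move=> /(card_le_surj x0)[l lP].
exists (fun n => if l n < a then l n else x0); split=> [n|x xa]; first by case: ifP.
have [y Ay xy] := A_cof x xa; have [n _ ln] := lP y Ay.
by exists n; rewrite ln (Aa y Ay).
Qed.

Lemma first_above (a : K) (l : L -> K) (x : K) :
  (forall x, x < a -> exists n, x <= l n) -> x < a ->
  exists2 n, x <= l n & forall k, k < n -> l k < x.
Proof.
move=> l_cof /l_cof lx.
have [//|n xn n_min] := well_order_min L_wo (A := [set n | x <= l n]).
exists n => // k kn; rewrite ltNge; apply/negP => /n_min.
by rewrite leNgt kn.
Qed.

(** With [l] cofinal in [a] and [n b] the first index such that [b < l (n b)], take the maximum of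
    [n b] and [e (l (n b)) b]. At [a] itself [n b] grows; below a smaller [a'] of cofinality [L] it
    is eventually a constant [k], and the injectivity of [e (l k)] takes over. *)
Lemma scale_exists (a : K) : E_cof L K a -> exists E, scale a E.
Proof.
move=> aE; have [l [la l_cof]] := cofinal_enum aE; have [l0] := L_inhabited.
have /choice[n nP] : forall b, exists n, b < a -> b < l n /\ forall k, k < n -> l k <= b.
  move=> b; have [ba|] := pselect (b < a); last by exists l0.
  have [_ /(_ b ba)[y b_y ya]] := E_cof_limit aE; have [m ym] := l_cof y ya.
  have [|n bn n_min] := well_order_min L_wo (A := [set n | b < l n]).
    by exists m; exact: lt_le_trans b_y ym.
  exists n => _; split=> // k kn; rewrite leNgt; apply/negP => /n_min.
  by rewrite leNgt kn.
have nE a' : E_cof L K a' -> a' < a -> exists2 x, x < a' & exists2 k, a' <= l k &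
    forall b, x <= b -> b < a' -> n b = k.
  move=> a'E a'a; have [k a'k kP] := first_above l_cof a'a.
  have [x xa' xP] := small_bounded_cof a'E (@small_below k) kP.
  exists x => //; exists k => // b xb ba'; have [bl bn] := nP b (lt_trans ba' a'a).
  apply/eqP; case: ltgtP => // [nk|kn].
    by have := lt_trans (lt_le_trans (xP _ nk) xb) bl; rewrite ltxx.
  by have := lt_le_trans ba' (le_trans a'k (bn _ kn)); rewrite ltxx.
exists (fun b => Order.max (n b) (e (l (n b)) b)); split.
- move=> a' m a'E; rewrite le_eqVlt => /orP[/eqP ->|a'a].
    have [||x xa xP] := @small_bounded_cof a L [set k | k <= m] l aE.
    + exact: small_le.
    + by move=> k _; exact: la.
    exists x => // b xb ba; rewrite lt_max ltNge; apply/orP; left; apply/negP => nm.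
    have [bl _] := nP b ba; have := lt_trans (lt_le_trans (xP _ nm) xb) bl.
    by rewrite ltxx.
  have [x xa' [k a'k kP]] := nE a' a'E a'a.
  have [||y ya' yP] := @small_bounded_cof a' K
      [set b | b < a' /\ e (l k) b <= m] id a'E.
  + apply: (small_card_le _ (@small_le m)).
    apply: (@card_le_injW _ _ _ _ (e (l k))) => [b []//|b b' [ba' _] [b'a' _]].
    by apply: eI; apply: lt_le_trans a'k.
  + by move=> b [].
  exists (Order.max x y) => [|b]; first by rewrite gt_max xa'.
  rewrite ge_max => /andP[xb yb] ba'; rewrite kP // lt_max [_ < e _ _]ltNge.
  apply/orP; right; apply/negP => em; have := yP b (conj ba' em).
  by rewrite ltNge yb.
- move=> a' a'E a'a; have [x xa' [k a'k kP]] := nE a' a'E a'a.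
  by exists x, (l k), k; split=> // b xb ba'; rewrite kP.
Qed.

Variable c : L -> K -> L.
Variable E : K -> K -> L.
Hypothesis E_scale : forall a, E_cof L K a -> scale a (E a).

Definition agree (f g : L -> L) (n : L) : Prop := forall x, x < n -> f x = g x.

Definition near (a : K) (y : L -> L) : set K :=
  [set b | b < a /\ exists n, [/\ agree (c ^~ b) y n, c n b <> y n & E a b <= y n]].

Definition bounded_in (A : set K) (a : K) : Prop :=
  exists2 x, x < a & forall b, A b -> b < a -> b < x.

Lemma bounded_in_sub (A B : set K) (a : K) :
  A `<=` B -> bounded_in B a -> bounded_in A a.
Proof. by move=> AB [x xa xP]; exists x => // b /AB; exact: xP. Qed.

Lemma bounded_in_bigcup (J : Type) (I : set J) (A : J -> set K) (a : K) :
  E_cof L K a -> small I -> (forall j, I j -> bounded_in (A j) a) ->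
  bounded_in (\bigcup_(j in I) A j) a.
Proof.
move=> aE I_small A_bnd.
have [[x0 x0a] _] := E_cof_limit aE.
have /choice[x xP] : forall j, exists x, I j -> x < a /\ forall b, A j b -> b < a -> b < x.
  move=> j; have [Ij|] := pselect (I j); last by exists x0.
  by have [x xa xP] := A_bnd j Ij; exists x.
have [|y ya yP] := small_bounded_cof (f := x) aE I_small.
  by move=> j /xP[].
exists y => // b [j Ij Ajb] ba; apply: lt_trans (yP j Ij).
by have [_] := xP j Ij; apply.
Qed.

(** The values [y n] with [n <= N] have a common bound, so high enough below [a'] a point of
    [near a y] can differ from [y] only after [N]. *)
Lemma scale_large (a a' : K) (y : L -> L) (N : L) :
  E_cof L K a -> E_cof L K a' -> a' <= a ->
  exists2 x, x < a' & forall b n, x <= b -> b < a' -> n <= N -> y n < E a b.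
Proof.
move=> aE a'E a'a; have [m mP] := small_bounded y (@small_le N).
have [/(_ a' m a'E a'a)[x xa' xP] _] := E_scale aE.
exists x => // b n xb ba' nN; exact: lt_trans (mP n nN) (xP b xb ba').
Qed.

Lemma neq_fun (y z : L -> L) : y <> z -> exists n, y n <> z n.
Proof.
move=> yz; apply: contrapT => ne; apply: yz; apply: funext => n.
by apply: contrapT => yzn; apply: ne; exists n.
Qed.

(* Past the point where y and z differ, c_b cannot follow both of them, so b
   leaves one of them early and then E a b or E a' b is bounded. *)
Lemma near_almost_disjoint (a a' : K) (y z : L -> L) :
  E_cof L K a -> E_cof L K a' -> a' <= a -> y <> z ->
  bounded_in (near a y `&` near a' z) a'.
Proof.
move=> aE a'E a'a /neq_fun[N yzN].
have [x xa' xP] := scale_large y N aE a'E a'a.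
have [x' x'a' x'P] := scale_large z N a'E a'E (lexx _).
exists (Order.max x x') => [|b]; first by rewrite gt_max xa'.
move=> [[_ [n [yn _ En]]] [_ [n' [zn _ En']]]] ba'.
rewrite ltNge ge_max; apply/negP => /andP[xb x'b].
case: (leP n N) => nN; first by have := xP b n xb ba' nN; rewrite ltNge En.
case: (leP n' N) => n'N; first by have := x'P b n' x'b ba' n'N; rewrite ltNge En'.
by apply: yzN; rewrite -yn // -zn.
Qed.

(* Used at the points where the guessing family fails to be cofinal.  The only
   possible accumulation point z of the functions c_b along the family is
   excluded from the branches chosen later. *)
Lemma default_family (a : K) : E_cof L K a -> exists (z : L -> L) (D : L -> set K),
  [/\ forall j, cofinal_below (D j) a,
      forall j j' b, D j b -> D j' b -> j = j',
      forall j a', E_cof L K a' -> a' < a -> bounded_in (D j) a' &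
      forall j y a', y <> z -> E_cof L K a' -> a <= a' ->
        bounded_in (D j `&` near a' y) a].
Proof.
move=> aE; have [l [la l_cof]] := cofinal_enum aE.
have [l0] := L_inhabited; have [pr prI] := L_pairing.
(* Keeping only the strict records of [l] makes [C] small below every [x < a]. *)
pose C := [set b | exists2 n, b = l n & forall k, k < n -> l k < l n].
have C_lt b : C b -> b < a by move=> [n -> _].
have C_small x : x < a -> small (C `&` below x).
  move=> xa; have [n xn] := l_cof x xa.
  apply: (small_card_le _ (small_image (f := l) (@small_le n))).
  apply: subset_card_le => b [[m -> mP]] lmx; exists m => //=.
  rewrite leNgt; apply/negP => /mP nm; have := lt_trans (lt_le_trans lmx xn) nm.
  by rewrite ltxx.
have C_cof x : x < a -> exists2 b, C b & x <= b.
  move=> /(first_above l_cof)[n xn nP]; exists (l n) => //; exists n => // k /nP.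
  by move/lt_le_trans; apply.
pose acc y := forall n x, x < a -> exists b, [/\ C b, x <= b & agree (c ^~ b) y n].
have [z zP] : exists z, (exists y, acc y) -> acc z.
  have [[y ay]|ny] := pselect (exists y, acc y); first by exists y.
  by exists (fun=> l0) => /ny.
(* If an accumulation point exists, the points [dd n] chosen from these sets converge to [z]. *)
pose U n := [set b | C b /\ (acc z -> agree (c ^~ b) z n)].
have U_cof n x : x < a -> exists2 b, U n b & x <= b.
  move=> xa; have [az|naz] := pselect (acc z).
    by have [b [Cb xb bz]] := az n x xa; exists b.
  by have [b Cb xb] := C_cof x xa; exists b => //; split=> // /naz.
have [|dd [dU d_neq]] := avoiding_choice a (U := U) (well_order_wf L_wo).
  move=> n h; have [||x xa xP] := @small_bounded_cof a L
      [set k | k < n /\ h k < a] h aE.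
  - apply: (small_card_le _ (@small_below n)).
    by apply: subset_card_le => k [].
  - by move=> k [].
  have [b Ub xb] := U_cof n x xa; exists b => // k kn hk.
  have := xP k (conj kn _); rewrite hk => /(_ (C_lt _ (proj1 Ub))).
  by rewrite ltNge xb.
have d_inj m n : dd m = dd n -> m = n.
  move=> mn; apply/eqP; case: ltgtP => // [mln|nlm].
    by have := d_neq _ _ mln.
  by have := d_neq _ _ nlm => /(_ (esym mn)).
have dC n : C (dd n) by case: (dU n).
exists z, (fun j => [set b | exists m, b = dd (pr j m)]); split.
- move=> j; split=> [_ [m ->]|x xa]; first exact: C_lt.
  (* If the set were bounded by [x], its [L] many distinct points would all lie in [C] below [x]. *)
  apply: contrapT => nb; apply: (C_small x xa).
  apply: (@card_le_injW _ _ _ _ (fun m => dd (pr j m))) => [m _|m m' _ _].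
    split=> //; rewrite /below /= ltNge; apply/negP => xm; apply: nb.
    by exists (dd (pr j m)) => //; exists m.
  by move/d_inj/prI => [].
- by move=> j j' b [m ->] [m'] /d_inj/prI[].
- move=> j a' a'E a'a; have [|x xa' xP] := small_bounded_cof (f := id) a'E (C_small _ a'a).
    by move=> b [].
  by exists x => // b [m ->] ma'; exact: xP.
- move=> j y a' yz a'E aa'.
  (* Either the functions at the [dd n] converge to [z], hence leave [y], or no accumulation point
     exists and [y] is not one. *)
  have [N [x xa xP]] : exists N, exists2 x, x < a &
      forall n, x <= dd n -> ~ agree (c ^~ (dd n)) y N.
    have [az|naz] := pselect (acc z); last first.
      apply: contrapT => nN; apply: naz; apply: zP; exists y => n x xa.
      apply: contrapT => nb; apply: nN; exists n, x => // k xk yk.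
      by apply: nb; exists (dd k).
    have [k yzk] := neq_fun yz; have [N kN] := L_gt k.
    have [|x xa xP] := small_bounded_cof (f := dd) aE (@small_below N).
      by move=> n _; exact: C_lt.
    exists N, x => // n xn yn; case: (ltP n N) => [/xP|Nn]; first by rewrite ltNge xn.
    apply: yzk; rewrite -yn //; have [_ /(_ az)] := dU n; apply.
    exact: lt_le_trans kN Nn.
  have [x' x'a x'P] := scale_large y N a'E aE aa'.
  exists (Order.max x x') => [|_ [[m ->] [_ [n [yn _ En]]]] ba]; first by rewrite gt_max xa.
  rewrite ltNge ge_max; apply/negP => /andP[xb x'b].
  case: (leP n N) => nN; first by have := x'P _ n x'b ba nN; rewrite ltNge En.
  by apply: (xP _ xb) => k kN; apply: yn; exact: lt_trans kN nN.
Qed.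

(** Fewer than [L] members of [D] are coded by a point [x] of [K] above their indices and the
    sequence of the numbers of these indices under [e x]. There are only [K] many codes, so a
    splitting realizes each stationarily often. *)
Lemma stationary_labels (Y : Type) (D : set Y) (y0 : Y) (S : set (set K)) :
  D y0 -> D #<= [set: K] -> trivIset S id -> (forall X, S X -> stationary X) ->
  exists (T : K -> L -> Y) (len : K -> L), (forall a l, D (T a l)) /\
    forall X (TT : L -> Y) l0, S X -> (forall l, D (TT l)) ->
      stationary [set a | [/\ X a, len a = l0 & forall l, l < l0 -> T a l = TT l]].
Proof.
move=> Dy0 DK S_triv S_st; have [f fP] := stationary_split2 S_triv S_st.
have [k] := K_inhabited; have [v0] := L_inhabited.
have pK : [set: pfun L L] #<= [set: K].
  exact: card_le_trans (@pfun_card_le setT) L_card_le_K.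
have [r rP] := card_le_surj (prestrict (fun=> v0) v0) pK.
have [i [_ iI]] := card_le_inj k DK.
have /choice[tr trP] : forall p : K * L, exists y, D y /\
    forall y', D y' -> i y' < p.1 -> e p.1 (i y') = p.2 -> y = y'.
  move=> [x v] /=.
  have [[y [Dy yx yv]]|ny] := pselect (exists y, [/\ D y, i y < x & e x (i y) = v]).
    exists y; split=> // y' Dy' y'x y'v; apply: iI => //.
    by apply: (eI yx y'x); rewrite yv.
  by exists y0; split=> // y' Dy' y'x y'v; case: ny; exists y'.
exists (fun a l => if pget (r (f a).2) l is Some v then tr ((f a).1, v) else y0).
exists (fun a => pdom (r (f a).2)); split=> [a l|X TT l0 SX DTT].
  by case: pget => // v; case: (trP ((f a).1, v)).
have [x xP] := @K_bounded _ _ (i \o TT) (card_lexx _).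
have [v _ rv] := rP (prestrict (fun l => e x (i (TT l))) l0) I.
apply: stationary_sub (fP X (x, v) SX) => a [Xa fa] /=; rewrite fa /= rv; split=> // l ll0.
rewrite /pget /=; case: pselect => // _.
by have [_ /(_ (TT l) (DTT l) (xP l I) erefl)] := trP (x, e x (i (TT l))).
Qed.

(** * Branches and the use of strong unboundedness *)

Hypothesis c_unb : strongly_unbounded c.

(** On a cofinal fiber every coordinate would take a single value, against strong unboundedness. *)
Lemma fiber_bounded (y : L -> L) : exists x, forall b, c ^~ b = y -> b <= x.
Proof.
apply: contrapT => nx.
have /c_unb[t t_unb] : cofinal [set b | c ^~ b = y].
  move=> x; apply: contrapT => nb; apply: nx; exists x => b by_.
  by case: (leP b x) => // /ltW xb; case: nb; exists b.
have [_ [b [by_ _] <-]] := t_unb (y (pdom t)).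
by rewrite -by_ ltxx.
Qed.

(** Recursion along the lexicographic order of the pairs [(a, m)]: at most [L] many functions are to
    be avoided, each with a bounded fiber, while the branches are unbounded. *)
Lemma distinct_branches (T : K -> L -> set (pfun L L)) (z : K -> L -> L) :
  (forall a m, large_trees c (T a m)) -> exists g : K -> L -> K,
  (forall a m, [/\ branches c (T a m) (g a m), a <= g a m &
     forall a', a' < a -> c ^~ (g a m) <> z a']) /\
  forall a m a' m', c ^~ (g a m) = c ^~ (g a' m') -> a = a' /\ m = m'.
Proof.
move=> T_large; have [l0] := L_inhabited; have [pr prI] := L_pairing.
have /choice[B BP] := fiber_bounded.
pose R (p q : K * L) := p.1 < q.1 \/ p.1 = q.1 /\ p.2 < q.2.
have R_wf : well_founded R.
  move=> [a m]; elim/(well_founded_ind (well_order_wf K_wo)): a m => a IHa m.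
  elim/(well_founded_ind (well_order_wf L_wo)): m => m IHm.
  by constructor=> -[a' m'] [/IHa|[/= -> /IHm]].
pose U (p : K * L) := [set y | exists g, [/\ branches c (T p.1 p.2) g, p.1 <= g,
  y = c ^~ g & forall a', a' < p.1 -> y <> z a']].
have [|y [yU y_neq]] := avoiding_choice (fun=> l0) (U := U) R_wf.
  (* The bound [a1] is above [a] so that [e a1] also numbers [a], which occurs in predecessors of
     [(a, m)]. *)
  move=> [a m] h; have [a1 aa1] := K_gt a.
  have [x1 x1P] := @K_bounded _ _ (fun a' => B (z a')) (below_card_le a).
  have [|x2 x2P] := @K_bounded _ [set p | R p (a, m)] (fun p => B (h p)).
    apply: (@card_le_injW _ _ _ _ (fun p => pr (e a1 p.1) p.2)) => //.
    have lt1 p : R p (a, m) -> p.1 < a1.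
      by move=> [/= /lt_trans|[/= -> _]]; [apply|].
    move=> [a' m'] [a'' m''] /lt1 /= a'1 /lt1 /= a''1 /prI[].
    by move=> /(eI a'1 a''1) -> ->.
  have [g Tg] := T_large a m (Order.max a (Order.max x1 x2)).
  rewrite !gt_max => /and3P[ag x1g x2g]; exists (c ^~ g).
    exists g; split=> // [|a' a'a ga']; first exact: ltW.
    by have := lt_trans x1g (le_lt_trans (BP _ _ ga') (x1P _ a'a)); rewrite ltxx.
  move=> p pR ph; have := lt_trans x2g (le_lt_trans (BP _ _ (esym ph)) (x2P _ pR)).
  by rewrite ltxx.
have /choice[g gP] := yU.
exists (fun a m => g (a, m)); split=> [a m|a m a' m'].
  by have [Tg ag yE zP] := gP (a, m); split=> // a' /zP; rewrite yE.
have [_ _ <- _] := gP (a, m); have [_ _ <- _] := gP (a', m') => yy.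
case: (ltgtP a a') => [aa'|a'a|aa'].
- by case: (y_neq (a', m') (a, m)); [left|].
- by case: (y_neq (a, m) (a', m')); [left|].
- split=> //; case: (ltgtP m m') => // mm'.
    by case: (y_neq (a', m') (a, m)); [right|].
  by case: (y_neq (a, m) (a', m')); [right|].
Qed.

Lemma near_hits (W Z : set K) (T : set (pfun L L)) (g : K -> K) :
  stationary W -> W `<=` E_cof L K ->
  (forall a, W a -> branches c T (g a) /\ a <= g a) ->
  (forall s, T s -> unbounded [set b | Z b /\ extended_by s (c ^~ b)]) ->
  exists2 a, W a & ~ bounded_in (near a (c ^~ (g a)) `&` Z) a.
Proof.
move=> W_st W_cof gP TZ; apply: contrapT => nW; have [l0] := L_inhabited.
have Wb a : W a -> bounded_in (near a (c ^~ (g a)) `&` Z) a.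
  by move=> Wa; apply: contrapT => nb; apply: nW; exists a.
(* Every node of [T] is extended by some [c_b] with [b] in [Z] between [x] and [G x]. *)
have /choice[G GP] : forall x, exists y, forall s, T s ->
    exists b, [/\ Z b, x <= b, b < y & extended_by s (c ^~ b)].
  move=> x; have /choice[b bP] : forall s, exists b, T s ->
      [/\ Z b, x <= b & extended_by s (c ^~ b)].
    move=> s; have [Ts|] := pselect (T s); last by exists x.
    by have [b [Zb sb] xb] := TZ s Ts x; exists b; split=> //; exact: ltW.
  have [y yP] := @K_bounded _ _ b (@pfun_card_le setT).
  by exists y => s Ts; have [? ? ?] := bP s Ts; exists (b s); split=> //; exact: yP.
(* [H x] lies in [W], so it has cofinality [L] and the coherence clause of [scale] applies to it. *)
have /choice[H HP] : forall x, exists y, [/\ W y, x < y & closed_under G y].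
  move=> x; have /stationaryP/(_ (fun z => Order.max (G z) x)) := W_st.
  move=> [a Wa [a_lim aG]]; have [[z za] _] := a_lim; exists a; split=> //.
    by have := aG z za; rewrite gt_max => /andP[].
  by split=> // w /aG; rewrite gt_max => /andP[].
(* The data to be frozen: [x] is a point past which [Z] misses the near set, [y] is past [G x], and
   [t], [k] determine [E a] between [x] and [y]. *)
pose P a x y t k := [/\ y < a, G x < y, forall b, x <= b -> b < y ->
  E a b = Order.max k (e t b) & forall b, Z b -> x <= b -> b < a -> ~ near a (c ^~ (g a)) b].
have WP a : [set a | W a /\ closed_under H a] a -> exists2 x, x < a &
    exists2 y, y < a & exists2 t, t < a & exists k, P a x y t k.
  move=> [Wa [a_lim aH]]; have [x xa xP] := Wb a Wa.
  have [WH xH [_ HG]] := HP x; have ya := aH x xa.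
  have [_ /(_ _ (W_cof _ WH) ya)[x' [t [k [x'y ta kP]]]]] := E_scale (W_cof _ Wa).
  have x''y : Order.max x x' < H x by rewrite gt_max xH.
  exists (Order.max x x'); first exact: lt_trans x''y ya.
  exists (H x) => //; exists t => //; exists k; split=> //; first exact: HG.
    by move=> b; rewrite ge_max => /andP[_]; exact: kP.
  move=> b Zb; rewrite ge_max => /andP[xb _] ba nb.
  by have := xP b (conj nb Zb) ba; rewrite ltNge xb.
have [x W1_st] := fodor (stationary_closed H W_st) WP.
have [y W2_st] := fodor W1_st (fun a Wa => proj2 Wa).
have [t W3_st] := fodor W2_st (fun a Wa => proj2 Wa).
have [k /= W4_st] := stationary_fiber (card_lexx _) W3_st (fun a Wa => proj2 Wa).
set W4 := (X in stationary X) in W4_st.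
have W4W a : W4 a -> W a by move=> [[[[[]]]]].
have W4P a : W4 a -> P a x y t k by case.
have /c_unb[s s_unb] : cofinal (g @` W4).
  move=> z; have [a W4a za] := stationary_unbounded W4_st z.
  exists (g a); first by exists a.
  exact: le_trans (ltW za) (proj2 (gP a (W4W a W4a))).
set n := pdom s in s_unb; have [n' nn'] := L_gt n.
(* Any branch through [s] serves to find a [b] in [Z], below [G x], with [c_b] extending [s]. *)
have [_ [_ [[a0 W4a0 <-] sa0] <-] _] := s_unb l0.
have [Ta0 _] := gP a0 (W4W a0 W4a0).
have [b [Zb xb bG /extended_by_prestrict ab]] := GP x _ (Ta0 n').
have [_ [_ [[a W4a <-] sa] <-]] :=
  s_unb (Order.max (Order.max k (e t b)) (c n b)).
rewrite gt_max => /andP[/ltW kb cb].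
have [ya Gy Eb nb] := W4P a W4a; have b_y := lt_trans bG Gy.
apply: (nb b Zb xb (lt_trans b_y ya)); split; first exact: lt_trans b_y ya.
exists n; split=> [z zn||]; last by rewrite Eb.
  rewrite /= -ab; last exact: lt_trans zn nn'.
  by have := sa (exist _ z zn); rewrite sa0.
by move=> cE; move: cb; rewrite cE ltxx.
Qed.

(** * Suprema, dense trees and the assembly of the guessing families *)

Lemma bounded_in_setU (A B : set K) (a : K) :
  bounded_in A a -> bounded_in B a -> bounded_in (A `|` B) a.
Proof.
move=> [x xa xP] [y ya yP]; exists (Order.max x y); first by rewrite gt_max xa.
by move=> b [/xP|/yP] lt_b /lt_b; rewrite lt_max => ->; rewrite ?orbT.
Qed.

Lemma cofinal_below_sup (A : set K) (a : K) :
  limit_ordinal a -> cofinal_below A a -> supremums A a.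
Proof.
move=> [_ a_lim] [Aa A_cof]; split=> [y /Aa/ltW//|x xP].
rewrite leNgt; apply/negP => /a_lim[y xy /A_cof[b Ab yb]].
by have := lt_le_trans xy (le_trans yb (xP b Ab)); rewrite ltxx.
Qed.

Lemma sup_lt (A : set K) (a x : K) : x < a -> (forall b, A b -> b <= x) ->
  exists2 s, supremums A s & s < a.
Proof.
move=> xa xP; have [|s sP s_min] := well_order_min K_wo (A := ubound A); first by exists x.
by exists s => //; apply: le_lt_trans xa; exact: s_min.
Qed.

End Guessing.

(** Past a common bound for the at most [L] many nodes that are met boundedly often, every [b] in
    [Z] is a branch. *)
Lemma limit_tree_large (c : L -> K -> L) (Z : set K) : unbounded Z ->
  large_trees c [set s | unbounded [set b | Z b /\ extended_by s (c ^~ b)]].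
Proof.
move=> Z_unb x.
have /choice[f fP] : forall s, exists y, ~ unbounded [set b | Z b /\ extended_by s (c ^~ b)] ->
    forall b, Z b -> extended_by s (c ^~ b) -> b <= y.
  move=> s; have [s_unb|] := pselect (unbounded [set b | Z b /\ extended_by s (c ^~ b)]).
    by exists x.
  move=> ns; apply: contrapT => ny; apply: ns => y; apply: contrapT => nb; apply: ny.
  exists y => _ b Zb sb; rewrite leNgt; apply/negP => yb; apply: nb.
  by exists b.
have [y yP] := @K_bounded _ _ f (@pfun_card_le setT).
have [b Zb] := Z_unb (Order.max x y); rewrite gt_max => /andP[xb yb].
exists b => // a; apply: contrapT => /fP/(_ b Zb) ba.
have : b <= f (prestrict (c ^~ b) a) by apply: ba; apply/extended_by_prestrict.
by move/(lt_le_trans yb)/lt_trans => /(_ _ (yP _ I)); rewrite ltxx.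
Qed.

Lemma tight_club_ad (c : L -> K -> L) (S : set (set K)) :
  tight c -> strongly_unbounded c ->
  partition S id (E_cof L K) -> (forall X, S X -> stationary X) -> club_ad S L L.
Proof.
move=> [D [D_large D_cof DK]] c_unb [S_cover S_triv _] S_st.
have S_cof X : S X -> X `<=` E_cof L K by move=> SX a Xa; rewrite -S_cover; exists X.
have [l0] := L_inhabited; have [pr prI] := L_pairing; have [e eI] := below_inj.
have /choice[E E_scale] : forall a, exists E, E_cof L K a -> scale e a E.
  move=> a; have [aE|] := pselect (E_cof L K a); last by exists (fun=> l0).
  by have [E ?] := scale_exists eI aE; exists E.
have [y0 Dy0 _] : exists2 T, D T & T `<=` setT.
  by apply: D_cof => x; have [y xy] := K_gt x; exists y.
have [T [len [DT T_guess]]] := stationary_labels eI Dy0 DK S_triv S_st.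
(* Branches at [a] are indexed by [m = pr l j]; [p1] recovers the number [l] of the tree, so each
   tree receives a branch for every [j]. *)
have /choice[p1 p1P] : forall m, exists l, forall l' j, pr l' j = m -> l = l'.
  move=> m; have [[l [j lj]]|nm] := pselect (exists l, exists j, pr l j = m).
    by exists l => l' j'; rewrite -lj => /prI[].
  by exists l0 => l' j lj; case: nm; exists l', j.
have /choice[zD zDP] : forall a, exists zD : (L -> L) * (L -> set K), E_cof L K a ->
  [/\ forall j, cofinal_below (zD.2 j) a,
      forall j j' b, zD.2 j b -> zD.2 j' b -> j = j',
      forall j a', E_cof L K a' -> a' < a -> bounded_in (zD.2 j) a' &
      forall j y a', y <> zD.1 -> E_cof L K a' -> a <= a' ->
        bounded_in (zD.2 j `&` near c E a' y) a].
  move=> a; have [aE|] := pselect (E_cof L K a); last by exists (fun=> l0, fun=> set0).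
  by have [z [Dd ?]] := default_family c E_scale aE; exists (z, Dd).
have [g [gP g_inj]] := distinct_branches eI c_unb (T := fun a m => T a (p1 m))
  (fun a => (zD a).1) (fun a m => D_large _ (DT a _)).
(* T a l runs over the fewer than L trees guessed at a; for each j, At a j
   collects a set near a branch of each of them.  The sets At a j are disjoint
   only up to bounded sets, hence An. *)
pose nr a l j := near c E a (c ^~ (g a (pr l j))).
pose At a j := \bigcup_(l in below (len a)) nr a l j.
pose An a j := At a j `\` \bigcup_(j' in below j) At a j'.
(* The default family keeps the sets cofinal and almost disjoint at points where the near sets fail
   to be cofinal. *)
pose good a := forall j, cofinal_below (An a j) a.
pose Aj a j := if pselect (good a) then An a j else (zD a).2 j.
have Aj_cof a j : E_cof L K a -> cofinal_below (Aj a j) a.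
  by move=> aE; rewrite /Aj; case: pselect => [ag|_] /=; [exact: ag|have [] := zDP a aE].
have Aj_triv a j j' b : E_cof L K a -> Aj a j b -> Aj a j' b -> j = j'.
  move=> aE; rewrite /Aj; case: pselect => [_|_] /=; last by have [_ h _ _] := zDP a aE; exact: h.
  move=> [jb nj] [j'b nj']; apply/eqP; case: ltgtP => // [jj'|j'j].
    by case: nj'; exists j.
  by case: nj; exists j'.
have small_len a : small (below (len a)) by exact: small_below.
have nr_ad a a' l j l' j' : E_cof L K a -> E_cof L K a' -> a' <= a ->
    a <> a' \/ j <> j' -> bounded_in (nr a l j `&` nr a' l' j') a'.
  move=> aE a'E a'a ne; apply: (near_almost_disjoint c E_scale) => //.
  by move=> /g_inj[aa' /prI[_ jj']]; case: ne.
have At_ad a a' l j j' : E_cof L K a -> E_cof L K a' -> a' <= a ->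
    a <> a' \/ j <> j' -> bounded_in (nr a l j `&` At a' j') a'.
  move=> aE a'E a'a ne; rewrite /At setI_bigcupr.
  by apply: bounded_in_bigcup => // l' _; exact: nr_ad.
have Aj_ad a a' j j' : E_cof L K a -> E_cof L K a' -> a' < a ->
    bounded_in (Aj a j `&` Aj a' j') a'.
  move=> aE a'E a'a; have aNa' : a <> a' by move=> aa'; move: a'a; rewrite aa' ltxx.
  rewrite {1}/Aj; case: pselect => [_|_] /=; last first.
    by have [_ _ /(_ j a' a'E a'a) + _] := zDP a aE; apply: bounded_in_sub => b [].
  apply: (@bounded_in_sub _ (At a j `&` Aj a' j')); first by move=> b [[]].
  rewrite /At setI_bigcupl; apply: bounded_in_bigcup => // l _.
  rewrite /Aj; case: pselect => [_|_] /=.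
    by apply: bounded_in_sub (At_ad a a' l j j' aE a'E (ltW a'a) (or_introl aNa')) => b [? []].
  (* The default family at [a'] has the exceptional function [(zD a').1], which the branches chosen
     at [a > a'] avoid. *)
  rewrite setIC; have [_ _ _] := zDP a' a'E; apply=> //; last exact: ltW.
  by have [_ _] := gP a (pr l j); apply.
exists (fun a => range (Aj a)); split.
- move=> a aS a_lim; have aE : E_cof L K a by rewrite -S_cover.
  have Aj_inj : injective (Aj a).
    move=> j j' jj'; have [[x xa] _] := a_lim.
    have [_ /(_ x xa)[b jb _]] := Aj_cof a j aE.
    by apply: (Aj_triv a _ _ b aE jb); rewrite -jj'.
  split.
  + by move=> _ _ [j _ <-] [j' _ <-] [b [jb j'b]]; rewrite (Aj_triv a j j' b aE jb j'b).
  + by apply: inj_card_eq => x y _ _; exact: Aj_inj.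
  + by move=> _ [j _ <-]; exact: Aj_cof.
- move=> B B_card [BL nLB] X SX.
  have /choice[tz tzP] : forall Z, exists T, D T /\ (B Z -> forall s, T s ->
      unbounded [set b | Z b /\ extended_by s (c ^~ b)]).
    move=> Z; have [BZ|] := pselect (B Z); last by exists y0.
    have [T' DT' T'P] := D_cof _ (limit_tree_large c (card_eq_unbounded (B_card Z BZ))).
    by exists T'; split=> // _ s /T'P.
  (* As [B] has fewer than [L] members, its numbering has a bound [a0], the length of the list of
     trees to be guessed. *)
  have [u [_ uI]] := card_le_inj l0 BL.
  have [a0 a0P] := small_bounded u nLB.
  have /choice[TT TTP] : forall l, exists T, D T /\ forall Z, B Z -> u Z = l -> T = tz Z.
    move=> l; have [[Z BZ Zl]|nZ] := pselect (exists2 Z, B Z & u Z = l).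
      exists (tz Z); split=> [|Z' BZ' Z'l]; first by case: (tzP Z).
      by congr tz; apply: uI => //; rewrite Zl.
    by exists y0; split=> // Z BZ Zl; case: nZ; exists Z.
  have X0_st := T_guess X TT a0 SX (fun l => proj1 (TTP l)).
  set X0 := (X in stationary X) in X0_st.
  (* The failures for the member of [B] numbered [p.1] and the set with index [p.2]; only [L] many
     such sets have to be avoided. *)
  pose N (p : L * L) := [set a | X0 a /\ exists2 Z, B Z /\ u Z = p.1 &
    bounded_in (An a p.2 `&` Z) a].
  have N_ns p : ~ stationary (N p).
    case: p => l j N_st; have [k] := K_inhabited.
    have [a1 [_ [Z [BZ /= Zl] _]] _] := stationary_unbounded N_st k.
    have NE a : N (l, j) a -> E_cof L K a.
      by move=> [[Xa _ _] _]; exact: S_cof Xa.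
    have la0 : l < a0 by rewrite -Zl; exact: a0P.
    have [||a [[Xa len_a Ta] [Z' [BZ' /= Z'l] Z'_bnd]]] :=
      near_hits E_scale c_unb (Z := Z) (T := tz Z) (g := fun a => g a (pr l j))
        N_st NE.
    + move=> a [[Xa len_a Ta] _]; have [gb ag _] := gP a (pr l j); split=> //.
      move: gb; rewrite (p1P _ _ _ erefl) Ta //.
      by have [_ /(_ Z BZ Zl) ->] := TTP l.
    + by have [_ /(_ BZ)] := tzP Z.
    have aE : E_cof L K a := S_cof X SX a Xa.
    apply; have ZZ' : Z' = Z by apply: uI => //; rewrite Z'l.
    rewrite {}ZZ' in Z'_bnd.
    (* Passing from the near set to [An a j] removes only a bounded part, so a failure for [An] is a
       failure for [nr], which [near_hits] refutes. *)
    have nr_bnd : bounded_in (nr a l j `&` \bigcup_(j' in below j) At a j') a.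
      rewrite setI_bigcupr; apply: bounded_in_bigcup => //; first exact: small_below.
      move=> j' j'j; apply: At_ad => //; right=> jj'.
      by move: j'j; rewrite jj' /below /= ltxx.
    apply: bounded_in_sub (bounded_in_setU Z'_bnd nr_bnd) => b [nb Zb].
    have [bj|nbj] := pselect ((\bigcup_(j' in below j) At a j') b); first by right.
    by left; split=> //; split=> //; exists l => //; rewrite /below /= len_a.
  have LL : [set: L * L] #<= [set: L].
    apply: (@card_le_injW _ _ _ _ (fun p => pr p.1 p.2)) => // -[x y] [x' y'] _ _ /prI[].
    by move=> /= -> ->.
  apply: stationary_sub (stationary_avoid LL X0_st N_ns) => a [X0a nN].
  have [Xa _ _] := X0a; split=> // _ Z [j _ <-] BZ.
  have aE : E_cof L K a := S_cof X SX a Xa.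
  have hit j' : cofinal_below (An a j' `&` Z) a.
    split=> [b [[[l _ []]]//]|x xa]; apply: contrapT => nb.
    apply: (nN (u Z, j')); split=> //; exists Z => //; exists x => // b Zb ba.
    by rewrite ltNge; apply/negP => xb; apply: nb; exists b.
  have a_good : good a.
    move=> j'; have [_ j'_cof] := hit j'; split=> [b [[l _ []]]//|x /j'_cof[b [jb _] xb]].
    by exists b.
  apply: cofinal_below_sup; first exact: E_cof_limit.
  by rewrite /Aj; case: pselect => [_|[]] //=; exact: hit.
- move=> _ _ [X SX [a Xa [j _ <-]]] [X' SX' [a' Xa' [j' _ <-]]] YY'.
  have aE := S_cof _ SX a Xa; have a'E := S_cof _ SX' a' Xa'.
  have a_lim := E_cof_limit aE.
  have [Aj_lt _] := Aj_cof a j aE; have [Aj'_lt _] := Aj_cof a' j' a'E.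
  suff [x xa xP] : exists2 x, x < a & forall b, (Aj a j `&` Aj a' j') b -> b <= x.
    have [s sP sa] := sup_lt xa xP; exists s, a; split=> //.
    by apply: cofinal_below_sup => //; exact: Aj_cof.
  (* Almost disjointness matters only for [a < a']. Otherwise the second set lies below [a' < a], or
     both sets belong to the same point and are disjoint. *)
  case: (ltgtP a a') => [aa'|a'a|aa'].
  + have [x xa xP] := Aj_ad a' a j' j a'E aE aa'; exists x => // b [jb j'b].
    by apply: ltW; apply: xP => //; exact: Aj_lt.
  + by exists a' => // b [_ /Aj'_lt/ltW].
  + have [[x xa] _] := a_lim; exists x => // b [jb]; rewrite -aa' => j'b.
    by case: YY'; rewrite -aa' (Aj_triv a j j' b aE jb j'b).
Qed.

End SuccessorCardinal.

Theorem theoremA (d d' : Order.disp_t) (L : orderType d) (K : orderType d')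
    (L_card : is_infinite_cardinal L) (L_reg : is_regular L)
    (L_pow : [set: L] #= [set: pfun L L])
    (K_succ : is_succ_cardinal L K) :
  ((exists X : set (L -> L), is_luzin K X) ->
   exists c : L -> K -> L, tight c /\ strongly_unbounded c)
  /\
  ((exists c : L -> K -> L, tight c /\ strongly_unbounded c) ->
   forall S : set (set K),
     partition S id (E_cof L K) -> (forall X, S X -> stationary X) ->
     club_ad S L L).
Proof.
split=> [[X]|[c [c_tight c_unb]] S S_part S_st]; first exact: luzin_coloring.
exact: (tight_club_ad L_card L_reg L_pow K_succ c_tight c_unb S_part S_st).
Qed.
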